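(* Let $n\ge 3$. The maximum of the supermodular rank over all functions $f:\{0,1\}^n\to\mathbb{R}$ is $\lceil\log_2 n\rceil+1$. Moreover, every submodular function in the interior of $-\mathcal{L}_{(1,\ldots,1)}$ has supermodular rank $\lceil\log_2 n\rceil$.
   Context: A tuple $\pi=(\pi_1,\ldots,\pi_n)$ of linear orders on $\{0,1\}$ defines a product order on $\{0,1\}^n$: $x\le_\pi y$ iff $x_i\le_{\pi_i}y_i$ for all $i$. This is a lattice order with meet $\wedge$ and join $\vee$ depending on $\pi$. A function $f:\{0,1\}^n\to\mathbb{R}$ is $\pi$-supermodular if $f(x)+f(y)\le f(x\wedge y)+f(x\vee y)$ for all $x,y$. The sign vector $\tau\in\{\pm1\}^n$ of $\pi$ has $\tau_i=1$ if $0<_{\pi_i}1$ and $\tau_i=-1$ if $1<_{\pi_i}0$; $\mathcal{L}_\tau=\mathcal{L}_\pi\subseteq\mathbb{R}^{\{0,1\}^n}$ denotes the cone of $\pi$-supermodular functions. Thus $\mathcal{L}_{(1,\ldots,1)}$ is the cone of ordinary supermodular functions, and $-\mathcal{L}_{(1,\ldots,1)}$ is the cone of ordinary submodular functions. The supermodular rank of $f:\{0,1\}^n\to\mathbb{R}$ is the smallest $r$ such that $f=f_1+\cdots+f_r$, where each $f_i$ is $\pi$-supermodular for some product order $\pi$ (which may differ between summands). *)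

(* Defs.v *)
(* MathComp-Analysis; the reals are an arbitrary [R : realType]. *)
From mathcomp Require Import all_boot all_order all_algebra.
From mathcomp Require Import all_classical all_reals all_analysis.

Set Implicit Arguments.
Unset Strict Implicit.
Unset Printing Implicit Defensive.

Import Order.TTheory GRing.Theory Num.Theory.
Import numFieldNormedType.Exports.

Local Open Scope classical_set_scope.
Local Open Scope ring_scope.

Definition cube (n : nat) : Type := {ffun 'I_n -> bool}.

(* {0,1} is [bool], with 0 = [false] and 1 = [true]; reflexivity of the order
   follows from totality. *)
Record linorder01 : Type := LinOrder01 {
  le01 :> rel bool;
  le01_anti : antisymmetric le01;
  le01_trans : transitive le01;
  le01_total : total le01 }.

Definition prod_le (n : nat) (pi : 'I_n -> linorder01) (x y : cube n) : bool :=
  [forall i, pi i (x i) (y i)].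

Definition prod_meet (n : nat) (pi : 'I_n -> linorder01) (x y : cube n)
    : cube n :=
  [ffun i => if pi i (x i) (y i) then x i else y i].

Definition prod_join (n : nat) (pi : 'I_n -> linorder01) (x y : cube n)
    : cube n :=
  [ffun i => if pi i (x i) (y i) then y i else x i].

Lemma le01_refl (l : linorder01) : reflexive l.
Proof. by move=> a; have := le01_total l a a; rewrite orbb. Qed.

Lemma le01_tf (l : linorder01) : l true false = ~~ l false true.
Proof.
have := le01_total l true false; have := @le01_anti l true false.
by case: (l true false); case: (l false true) => //= /(_ isT).
Qed.

Lemma prod_meetP (n : nat) (pi : 'I_n -> linorder01) (x y z : cube n) :
  prod_le pi z (prod_meet pi x y) = prod_le pi z x && prod_le pi z y.
Proof.
apply/forallP/andP => [h | [/forallP zx /forallP zy] i]; last first.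
  by rewrite ffunE; case: ifP.
split; apply/forallP => i; have := h i; rewrite ffunE; case: ifP => // xy zi.
- have yx : pi i (y i) (x i) by have := le01_total (pi i) (x i) (y i); rewrite xy.
  exact: (@le01_trans _ _ _ _ zi yx).
- exact: (@le01_trans _ _ _ _ zi xy).
Qed.

Lemma prod_joinP (n : nat) (pi : 'I_n -> linorder01) (x y z : cube n) :
  prod_le pi (prod_join pi x y) z = prod_le pi x z && prod_le pi y z.
Proof.
apply/forallP/andP => [h | [/forallP xz /forallP yz] i]; last first.
  by rewrite ffunE; case: ifP.
split; apply/forallP => i; have := h i; rewrite ffunE; case: ifP => // xy zi.
- exact: (@le01_trans _ _ _ _ xy zi).
- have yx : pi i (y i) (x i) by have := le01_total (pi i) (x i) (y i); rewrite xy.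
  exact: (@le01_trans _ _ _ _ yx zi).
Qed.

Definition supermodular (R : realType) (n : nat) (pi : 'I_n -> linorder01)
    (f : cube n -> R) : Prop :=
  forall x y, f x + f y <= f (prod_meet pi x y) + f (prod_join pi x y).

Definition sign_vector (n : nat) (pi : 'I_n -> linorder01) (i : 'I_n) : int :=
  if pi i false true then 1 else -1.

(* The topology on functions on the cube is the product topology of
   R^({0,1}^n). *)
Definition supermodular_cone (R : realType) (n : nat) (tau : 'I_n -> int)
    : set {ptws cube n -> R} :=
  [set f | exists pi : 'I_n -> linorder01,
     (forall i, sign_vector pi i = tau i) /\ supermodular pi f].

Definition neg_cone (R : realType) (n : nat) (L : set {ptws cube n -> R})
    : set {ptws cube n -> R} :=
  [set f | L (fun x => - f x)].

Lemma supermodular_coneE (R : realType) (n : nat) (pi : 'I_n -> linorder01)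
    (f : cube n -> R) :
  supermodular_cone (sign_vector pi) f <-> supermodular pi f.
Proof.
split=> [[pi' [sgn fpi']] | fpi]; last by exists pi.
have E i : pi' i =2 pi i.
  have := sgn i; rewrite /sign_vector => sgni.
  have ft : pi' i false true = pi i false true.
    by move: sgni; case: (pi' i _ _); case: (pi i _ _).
  by case=> [] []; rewrite ?le01_refl // !le01_tf ft.
move=> x y; have := fpi' x y.
suff [-> ->] : prod_meet pi' x y = prod_meet pi x y /\
               prod_join pi' x y = prod_join pi x y by [].
by split; apply/ffunP => i; rewrite !ffunE E.
Qed.

Definition supermodular_sum (R : realType) (n : nat) (f : cube n -> R)
    (r : nat) : Prop :=
  exists g : 'I_r -> cube n -> R,
    (forall k, exists pi : 'I_n -> linorder01, supermodular pi (g k)) /\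
    (forall x, f x = \sum_(k < r) g k x).

(* A relation rather than a function: that every function has a supermodular
   rank is itself to be proved. *)
Definition is_supermodular_rank (R : realType) (n : nat) (f : cube n -> R)
    (r : nat) : Prop :=
  supermodular_sum f r /\ (forall s, supermodular_sum f s -> (r <= s)%N).

Lemma up_log2_ceil (R : realType) (n : nat) : (0 < n)%N ->
  Num.ceil (ln (n%:R : R) / ln 2) = (up_log 2 n)%:Z.
Proof.
move=> n_gt0; have ln2_gt0 : 0 < ln (2 : R) by rewrite ln_gt0 // ltr1n.
have lnX k : ln ((2 ^ k)%N%:R : R) = k%:R * ln 2.
  by rewrite natrX lnXn ?ltr0n // mulr_natl.
apply: ceil_def; rewrite ltr_pdivlMr // ler_pdivrMr //.
have -> : (up_log 2 n)%:Z%:~R = (up_log 2 n)%:R :> R by [].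
rewrite -lnX ler_ln ?posrE ?ltr0n ?expn_gt0 // ler_nat up_logP // andbT.
case: (leqP n 1) => n1.
  have -> : n = 1%N by apply/eqP; rewrite eqn_leq n1.
  by rewrite up_log1 ln1 sub0r intrN mulN1r oppr_lt0.
have := up_log_gtn (isT : (1 < 2)%N) n1.
have : (0 < up_log 2 n)%N by rewrite up_log_gt0.
case: (up_log 2 n) => // k _ /=.
rewrite -(ltr_nat R) -ltr_ln ?posrE ?ltr0n ?expn_gt0 // lnX.
by have -> : k.+1%:Z - 1 = k%:Z by rewrite -addn1 PoszD addrK.
Qed.

(* Main.v *)
Require Import Defs.
From mathcomp Require Import all_boot all_order all_algebra.
From mathcomp Require Import all_classical all_reals all_analysis.
From mathcomp Require Import ring lra.

Import Order.TTheory GRing.Theory Num.Theory.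
Import numFieldNormedType.Exports.

(** For coordinates i <> j, let D_ij f be the second difference of f along the
    square spanned by i and j.  A function is supermodular for the product
    order of sign vector tau exactly when tau_i tau_j D_ij f >= 0 on all these
    squares ([supermodularP]), so everything happens in these differences.

    Take sign vectors tau^1, ..., tau^r and give coordinate i the codeword
    (tau^1_i, ..., tau^r_i), where the codewords are pairwise distinct.  Only
    the products tau^k_i tau^k_j matter: an order k that separates i and j
    allows D_ij <= 0, the other orders allow D_ij >= 0.  For a pair separated
    by some of the r orders but not by all of them, D_ij f can therefore be
    anything, since summands with large second differences of opposite signs
    can be made to cancel.  A pair of antipodal
    codewords is separated by every order and forces D_ij f <= 0.  These are
    the only constraints.  With q_k = (sum_i tau^k_i x_i)^2, whose second
    differences are the constants 2 tau^k_i tau^k_j, the summands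
      f_k = (f + C (r q_k - sum_l q_l)) / r
    add up to f.  The quadratic correction has no effect on antipodal pairs,
    and for C large it gives D_ij f_k the right sign on all the other pairs
    ([supermodular_sum_of_separating]).

    Upper bounds: ceil(log2 n) bits give n distinct codewords, which is enough
    when f is submodular; prefixing them with a constant bit excludes antipodal
    pairs, so one more order is enough for every f.

    Lower bounds: if every D_ij f takes a negative value then the codewords are
    distinct, so n <= 2^r.  If every D_ij f takes both signs then the codewords
    are moreover pairwise not antipodal, so n <= 2^(r - 1).  The first
    applies to the interior of the submodular cone, the second to the parity
    function, whose second differences change sign with any third
    coordinate. *)

Set Implicit Arguments.
Unset Strict Implicit.
Unset Printing Implicit Defensive.

Local Open Scope classical_set_scope.
Local Open Scope ring_scope.

(** * Supermodular set functions *)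

Lemma le_set0_of_le_setU1 (R : realType) (T : finType) (h : {set T} -> R)
    (S : {set T}) :
  (forall (A : {set T}) i, i \in S -> i \notin A -> h A <= h (i |: A)%SET) ->
  h finset.set0 <= h S.
Proof.
move: {2}#|S| (erefl #|S|) => k; elim: k S => [|k IHk] S cardS hS.
  by move/eqP: cardS; rewrite cards_eq0 => /eqP ->.
have /card_gt0P[i iS] : (0 < #|S|)%N by rewrite cardS.
rewrite -(finset.setD1K iS).
apply: (@le_trans _ _ (h (S :\ i)%SET)); last by rewrite hS // !inE eqxx.
apply: IHk => [|A j]; last by rewrite !inE => /andP[_ jS]; exact: hS.
by apply/eqP; rewrite -eqSS -cardS (cardsD1 i S) iS.
Qed.

(** Summing the local inequalities over i in A says that the increment of F
    from adding an element of B grows when A is added; summing over B then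
    gives the inequality for A and B.  The local inequalities are only available
    for i in A and j in B, because only then are both coordinates at their lower
    value in the application to the cube. *)
Lemma set_supermodular_of_local (R : realType) (T : finType)
    (F : {set T} -> R) (A B : {set T}) :
  (forall i, i \in A -> i \notin B) ->
  (forall (C : {set T}) i j, i \in A -> j \in B -> i \notin C -> j \notin C ->
     F (i |: C)%SET + F (j |: C)%SET <= F C + F (i |: (j |: C))%SET) ->
  F A + F B <= F finset.set0 + F (A :|: B)%SET.
Proof.
move=> dAB locF.
suff : F (finset.set0 :|: A)%SET - F finset.set0 <= F (B :|: A)%SET - F B.
  by rewrite finset.set0U (finset.setUC B A); lra.
apply: (@le_set0_of_le_setU1 _ _ (fun C => F (C :|: A)%SET - F C)) => C j jB jC.
suff : F (j |: (finset.set0 :|: C))%SET - F (finset.set0 :|: C)%SET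
        <= F (j |: (A :|: C))%SET - F (A :|: C)%SET.
  rewrite finset.set0U -finset.setUA (finset.setUC A C); lra.
apply: (@le_set0_of_le_setU1 _ _
  (fun D => F (j |: (D :|: C))%SET - F (D :|: C)%SET)) => D i iA iD.
have ij : i != j by apply: contraTneq jB => <-; exact: dAB.
rewrite -!finset.setUA.
(* C and D need not be disjoint from A and B: the step is an equality whenever
   i or j is already present. *)
have [iC|iC] := boolP (i \in C).
  suff -> : (i |: (D :|: C))%SET = (D :|: C)%SET by [].
  by apply/finset.setUidPr; rewrite finset.sub1set !inE iC orbT.
have [jD|jD] := boolP (j \in D).
  have e (E : {set T}) : j \in E -> (j |: E)%SET = E.
    by move=> jE; apply/finset.setUidPr; rewrite finset.sub1set.
  by rewrite !e ?subrr // !inE jD ?orbT.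
have := locF (D :|: C)%SET i j iA jB.
rewrite !inE (negPf iC) (negPf iD) (negPf jC) (negPf jD) => /(_ isT isT).
rewrite (_ : j |: (i |: (D :|: C)) = i |: (j |: (D :|: C)))%SET; first by lra.
exact: finset.setUCA.
Qed.

(** * Second differences and product orders *)

Definition upd2 n (i j : 'I_n) (a b : bool) (x : cube n) : cube n :=
  [ffun k => if k == i then a else if k == j then b else x k].

Definition diff2 (R : realType) n (f : cube n -> R) (i j : 'I_n)
    (x : cube n) : R :=
  f (upd2 i j true true x) - f (upd2 i j true false x)
  - f (upd2 i j false true x) + f (upd2 i j false false x).

Lemma diff2_sum (R : realType) n r (g : 'I_r -> cube n -> R) (i j : 'I_n)
    (x : cube n) :
  diff2 (fun y => \sum_(k < r) g k y) i j x = \sum_(k < r) diff2 (g k) i j x.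
Proof. by rewrite /diff2 -!sumrB -big_split. Qed.

Lemma norm_diff2_le (R : realType) n (f : cube n -> R) (i j : 'I_n)
    (x : cube n) :
  `|diff2 f i j x| <= 4 * \sum_y `|f y|.
Proof.
have le1 y : `|f y| <= \sum_y `|f y|.
  by rewrite (bigD1 y) //= lerDl sumr_ge0.
have := le1 (upd2 i j true true x); have := le1 (upd2 i j true false x).
have := le1 (upd2 i j false true x); have := le1 (upd2 i j false false x).
move: (\sum_y _) => S; rewrite /diff2 !ler_norml.
by move=> /andP[? ?] /andP[? ?] /andP[? ?] /andP[? ?]; apply/andP; split; lra.
Qed.

Definition reversed n (pi : 'I_n -> linorder01) (i : 'I_n) : bool :=
  pi i true false.

(** In this form, [reversed pi i] is visibly the lower value of coordinate i. *)
Lemma prod_orderE n (pi : 'I_n -> linorder01) (i : 'I_n) (a b : bool) :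
  pi i a b = (a (+) reversed pi i) ==> (b (+) reversed pi i).
Proof.
rewrite /reversed; case: a b => [] []; rewrite ?le01_refl ?implybb //.
  by case: (pi i _ _).
by rewrite le01_tf; case: (pi i _ _).
Qed.

(** A square of the cube gives one incomparable pair of corners, which are its
    main or its other diagonal according to the signs of i and j; this is the
    direct implication.  Conversely, x and y are obtained from their meet by
    raising disjoint sets of coordinates A and B, and their join by raising
    both, so that supermodularity reduces to that of a set function. *)
Lemma supermodularP (R : realType) n (pi : 'I_n -> linorder01)
    (f : cube n -> R) :
  supermodular pi f <->
  (forall i j x, i != j ->
     0 <= (-1) ^+ (reversed pi i (+) reversed pi j) * diff2 f i j x).
Proof.
split=> [fpi i j x ij | locf x y].
  have upd2E a b c d : let u := upd2 i j a b x in let v := upd2 i j c d x in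
      (prod_meet pi u v = upd2 i j (if pi i a c then a else c)
                                   (if pi j b d then b else d) x)
      * (prod_join pi u v = upd2 i j (if pi i a c then c else a)
                                     (if pi j b d then d else b) x).
    by split; apply/ffunP => k; rewrite !ffunE; case: eqP => [->|_] //;
       case: eqP => [->|_] //; rewrite if_same.
  have := fpi (upd2 i j true false x) (upd2 i j false true x).
  have := fpi (upd2 i j true true x) (upd2 i j false false x).
  rewrite !upd2E !prod_orderE /diff2.
  by case: (reversed pi i); case: (reversed pi j); rewrite /= ?expr0 ?expr1; lra.
set m := prod_meet pi x y.
pose flip (C : {set 'I_n}) : cube n := [ffun k => m k (+) (k \in C)].
pose A := [set i | x i != m i]%SET; pose B := [set i | y i != m i]%SET.
have m_low i : (i \in A) || (i \in B) -> m i = reversed pi i.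
  rewrite !inE !ffunE prod_orderE.
  by case: (x i); case: (y i); case: (reversed pi i).
have flipE C k : flip C k = m k (+) (k \in C) by rewrite ffunE.
have flip0 : flip finset.set0 = m by apply/ffunP => k; rewrite ffunE inE addbF.
have flipA : flip A = x.
  by apply/ffunP => k; rewrite ffunE inE; case: (x k); case: (m k).
have flipB : flip B = y.
  by apply/ffunP => k; rewrite ffunE inE; case: (y k); case: (m k).
have flipU : flip (A :|: B)%SET = prod_join pi x y.
  apply/ffunP => k; rewrite !ffunE !inE !ffunE prod_orderE.
  by case: (x k); case: (y k); case: (reversed pi k).
rewrite -[m]flip0 -flipU -{1}flipA -{1}flipB.
have dAB k : k \in A -> k \notin B.
  by rewrite !inE !ffunE; case: ifP => _; rewrite eqxx.
apply: (@set_supermodular_of_local _ _ (f \o flip)) => // C i j iA jB iC jC /=.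
have ij : i != j by apply: contraTneq jB => <-; exact: dAB.
have updE (E : {set 'I_n}) a b :
    (forall k, k != i -> k != j -> (k \in E) = (k \in C)) ->
    reversed pi i (+) (i \in E) = a -> reversed pi j (+) (j \in E) = b ->
    flip E = upd2 i j a b (flip C).
  move=> EC <- <-; apply/ffunP => k; rewrite [RHS]ffunE !flipE.
  case: eqP => [->|/eqP ki]; first by rewrite m_low ?iA.
  case: eqP => [->|/eqP kj]; first by rewrite m_low ?jB ?orbT.
  by rewrite EC.
have := locf i j (flip C) ij; rewrite /diff2.
rewrite (congr1 f (updE C (reversed pi i) (reversed pi j) _ _ _))
  ?(negPf iC, negPf jC, addbF) //.
rewrite (updE (i |: C)%SET (~~ reversed pi i) (reversed pi j)); last first.
- by rewrite !inE (negPf jC) eq_sym (negPf ij) addbF.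
- by rewrite !inE eqxx addbT.
- by move=> k ki kj; rewrite !inE (negPf ki).
rewrite (updE (j |: C)%SET (reversed pi i) (~~ reversed pi j)); last first.
- by rewrite !inE eqxx addbT.
- by rewrite !inE (negPf iC) (negPf ij) addbF.
- by move=> k ki kj; rewrite !inE (negPf kj).
rewrite (updE (i |: (j |: C))%SET (~~ reversed pi i) (~~ reversed pi j));
  last first.
- by rewrite !inE eqxx orbT addbT.
- by rewrite !inE eqxx addbT.
- by move=> k ki kj; rewrite !inE (negPf ki) (negPf kj).
by case: (reversed pi i); case: (reversed pi j); rewrite /= ?expr0 ?expr1; lra.
Qed.

Definition linorder01_of_reversed (s : bool) : linorder01.
Proof.
exists (fun a b => (a (+) s) ==> (b (+) s)).
- by case: s => [] [] [].
- by case: s => [] [] [] [].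
- by case: s => [] [] [].
Defined.

Lemma reversedK n (s : 'I_n -> bool) i :
  reversed (fun i => linorder01_of_reversed (s i)) i = s i.
Proof. by rewrite /reversed /=; case: (s i). Qed.

(** * Sums over a separating family of orders *)

Definition sqr_form (R : realType) n (s : 'I_n -> bool) (x : cube n) : R :=
  (\sum_(i < n) (-1) ^+ s i * (x i)%:R) ^+ 2.

Lemma diff2_sqr_form (R : realType) n (s : 'I_n -> bool) (i j : 'I_n)
    (x : cube n) : i != j ->
  diff2 (sqr_form R s) i j x = 2 * (-1) ^+ (s i (+) s j).
Proof.
move=> ij.
pose S : R := \sum_(k < n | (k != i) && (k != j)) (-1) ^+ s k * (x k)%:R.
have E a b : sqr_form R s (upd2 i j a b x)
    = ((-1) ^+ s i * a%:R + ((-1) ^+ s j * b%:R + S)) ^+ 2.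
  rewrite /sqr_form (bigD1 i) //= (bigD1 j) /=; last by rewrite eq_sym.
  rewrite !ffunE !eqxx eq_sym (negPf ij); congr ((_ + (_ + _)) ^+ 2).
  by apply: eq_bigr => k /andP[/negPf ki /negPf kj]; rewrite ffunE ki kj.
rewrite /diff2 !E signr_addb /=; ring.
Qed.

(** The column [s^~ k] lists the coordinates that order k reverses, and the row
    [s i] is the codeword of coordinate i.  With sg_k the sign of the pair
    i, j in order k, the correction contributes to r sg_k D_ij f_k the amount
    2 C sum_l (1 - sg_k sg_l): zero on an antipodal pair, at least 4 C on a pair
    whose signs are not all equal. *)
Lemma supermodular_sum_of_separating (R : realType) n (f : cube n -> R) r
    (s : 'I_n -> 'I_r -> bool) :
  (0 < r)%N ->
  (forall i j, i != j -> exists k, s i k != s j k) ->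
  (forall i j x, i != j -> (forall k, s i k != s j k) -> diff2 f i j x <= 0) ->
  supermodular_sum f r.
Proof.
move=> r_gt0 s_sep f_anti.
(* C need only dominate a quarter of the second differences of f. *)
pose q k := sqr_form R (s^~ k); pose C := \sum_y `|f y|.
have r_neq0 : r%:R != 0 :> R by rewrite pnatr_eq0 -lt0n.
exists (fun k x => r%:R^-1 * (f x + C * (r%:R * q k x - \sum_(l < r) q l x))).
split=> [k | x]; last first.
  rewrite -mulr_sumr big_split /= -mulr_sumr sumrB -mulr_sumr !sumr_const card_ord.
  by rewrite -[f x *+ r]mulr_natl -[X in _ - X]mulr_natl subrr mulr0 addr0 mulKf.
exists (fun i => linorder01_of_reversed (s i k)); apply/supermodularP => i j x ij.
rewrite !(reversedK (s^~ k)).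
pose sg l : R := (-1) ^+ (s i l (+) s j l).
have -> : diff2
    (fun y => r%:R^-1 * (f y + C * (r%:R * q k y - \sum_(l < r) q l y))) i j x
    = r%:R^-1 * (diff2 f i j x
                 + C * (2 * (r%:R * sg k - \sum_(l < r) sg l))).
  transitivity (r%:R^-1 * (diff2 f i j x + C * (r%:R * diff2 (q k) i j x
    - \sum_(l < r) diff2 (q l) i j x))).
    by rewrite -diff2_sum /diff2; ring.
  rewrite diff2_sqr_form // (eq_bigr (fun l => 2 * sg l)).
    by rewrite -mulr_sumr -/(sg k); ring.
  by move=> l _; rewrite diff2_sqr_form.
rewrite -/(sg k) mulrCA mulr_ge0 ?invr_ge0 ?ler0n //.
have -> : sg k * (diff2 f i j x + C * (2 * (r%:R * sg k - \sum_(l < r) sg l)))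
    = sg k * diff2 f i j x + 2 * C * \sum_(l < r) (1 - sg k * sg l).
  rewrite sumrB sumr_const card_ord -mulr_sumr.
  move: (\sum_l _) (sqrr_sign R (s i k (+) s j k)) => S; rewrite -/(sg k) => sg2.
  rewrite -[X in _ + _ * (X - _)]mul1r -sg2; ring.
have sg_ge0 l : 0 <= 1 - sg k * sg l.
  by rewrite /sg; do 2 case: (_ (+) _); rewrite ?expr0 ?expr1; lra.
have C_ge0 : 0 <= C by apply: sumr_ge0.
have [/forallP anti | ] := boolP [forall l, s i l != s j l].
  have := f_anti i j x ij anti.
  have S_ge0 : 0 <= \sum_(l < r) (1 - sg k * sg l) by apply: sumr_ge0.
  rewrite [X in X * diff2 _ _ _ _]/sg.
  have -> : s i k (+) s j k by have := anti k; do 2 case: (s _ k).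
  rewrite expr1; have := mulr_ge0 C_ge0 S_ge0; lra.
rewrite negb_forall => /existsP[l0]; rewrite negbK => /eqP l0E.
have [l1 l1E] := s_sep i j ij.
have [l sgl] : exists l, sg l = - sg k.
  case E : (s i k (+) s j k); [exists l0 | exists l1]; rewrite /sg E.
    by rewrite l0E addbb expr0 expr1 opprK.
  by move: l1E; do 2 case: (s _ l1).
have sum_ge2 : 2 <= \sum_(l < r) (1 - sg k * sg l).
  rewrite (bigD1 l) //= sgl -[leLHS]addr0 lerD ?sumr_ge0 //.
  by rewrite mulrN -expr2 sqrr_sign; lra.
have : 4 * C <= 2 * C * \sum_(l < r) (1 - sg k * sg l).
  by rewrite (_ : 4 * C = 2 * C * 2) ?ler_wpM2l ?mulr_ge0 //; ring.
have := norm_diff2_le f i j x; rewrite -/C ler_norml => /andP[].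
by rewrite /sg; case: (_ (+) _); rewrite ?expr0 ?expr1; lra.
Qed.

(** * Binary codes *)

Lemma leq_exp2_of_separating n r (c : 'I_n -> 'I_r -> bool) :
  (forall i j, i != j -> exists k, c i k != c j k) -> (n <= 2 ^ r)%N.
Proof.
move=> c_sep; have -> : (2 ^ r = #|{ffun 'I_r -> bool}|)%N.
  by rewrite card_ffun card_bool card_ord.
rewrite -[n in (n <= _)%N]card_ord.
apply: (@leq_card _ _ (fun i => [ffun k => c i k])) => i j.
move=> /ffunP cij; apply: contrapT => /eqP /c_sep[k].
by have := cij k; rewrite !ffunE => ->; rewrite eqxx.
Qed.

Lemma exists_separating n r : (n <= 2 ^ r)%N ->
  exists c : 'I_n -> 'I_r -> bool,
    forall i j, i != j -> exists k, c i k != c j k.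
Proof.
move=> le_n; have {}le_n : (n <= #|{ffun 'I_r -> bool}|)%N.
  by rewrite card_ffun card_bool card_ord.
exists (fun i => (enum_val (widen_ord le_n i) : {ffun _ -> _})) => i j.
apply: contraNP.
move=> /forallNP eq_ij; apply/eqP/val_inj.
have /(congr1 val) // : widen_ord le_n i = widen_ord le_n j.
apply: enum_val_inj; apply/ffunP => k.
by have /negP := eq_ij k; rewrite negbK => /eqP.
Qed.

(** * Lower bounds on the number of summands *)

(** If every summand had the weak sign opposite to that of D_ij f at x, so would
    f.  The bit b treats both signs at once: false gives an order that
    separates i and j, true one that does not. *)
Lemma exists_separating_order (R : realType) n (f : cube n -> R) r
    (g : 'I_r -> cube n -> R) (pi : 'I_r -> 'I_n -> linorder01)
    (i j : 'I_n) (x : cube n) (b : bool) :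
  (forall k, supermodular (pi k) (g k)) -> (forall y, f y = \sum_(k < r) g k y) ->
  i != j -> (-1) ^+ b * diff2 f i j x < 0 ->
  exists k, reversed (pi k) i (+) reversed (pi k) j != b.
Proof.
move=> gpi fE ij neg.
apply: contrapT => /forallNP all_eq.
move: neg; rewrite ltNge => /negP; case.
have -> : f = fun y => \sum_(k < r) g k y by apply/funext.
rewrite diff2_sum mulr_sumr sumr_ge0 // => k _.
have /negP := all_eq k; rewrite negbK => /eqP <-.
by have /supermodularP -> := gpi k.
Qed.

Lemma up_log_le_of_diff2_lt0 (R : realType) n (f : cube n -> R) r :
  (forall i j : 'I_n, i != j -> exists x, diff2 f i j x < 0) ->
  supermodular_sum f r -> (up_log 2 n <= r)%N.
Proof.
move=> neg [g [/choice[pi gpi] fE]]; apply: up_log_min => //.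
apply: (@leq_exp2_of_separating _ _ (fun i k => reversed (pi k) i)) => i j ij.
have [x neg_x] := neg i j ij.
have [|k] := exists_separating_order (x := x) (b := false) gpi fE ij.
  by rewrite expr0 mul1r.
by exists k; case: (reversed _ i) p; case: (reversed _ j).
Qed.

(** Codewords that are distinct and not antipodal stay distinct modulo
    complementation.  Adding the first bit to the others picks one
    representative of each class, and the first bit can then be dropped. *)
Lemma up_log_lt_of_diff2_both_signs (R : realType) n (f : cube n -> R) r :
  (1 < n)%N ->
  (forall i j : 'I_n, i != j ->
     (exists x, diff2 f i j x < 0) /\ (exists x, 0 < diff2 f i j x)) ->
  supermodular_sum f r -> (up_log 2 n < r)%N.
Proof.
move=> n_gt1 both f_sum.
have := up_log_le_of_diff2_lt0 (fun i j ij => (both i j ij).1) f_sum.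
case: r f_sum => [|r]; first by rewrite leqn0 up_log_eq0 /= leqNgt n_gt1.
move=> [g [/choice[pi gpi] fE]] _; rewrite ltnS; apply: up_log_min => //.
pose c i k := reversed (pi k) i.
apply: (@leq_exp2_of_separating _ _ (fun i k => c i (lift ord0 k) (+) c i ord0)).
move=> i j ij; have [[x neg_x] [y pos_y]] := both i j ij.
have [|k] := exists_separating_order (x := x) (b := false) gpi fE ij.
  by rewrite expr0 mul1r.
have [|l] := exists_separating_order (x := y) (b := true) gpi fE ij.
  by rewrite expr1 mulN1r oppr_lt0.
rewrite -!/(c _ _) => l_eq k_neq.
(* A bit m on which i and j compare differently than on the first bit still
   distinguishes them after normalization. *)
have sep m : c i m (+) c j m != c i ord0 (+) c j ord0 ->
    exists k, c i (lift ord0 k) (+) c i ord0 != c j (lift ord0 k) (+) c j ord0.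
  case: (unliftP ord0 m) => [m' -> neq | ->]; last by rewrite eqxx.
  by exists m'; move: neq; do 4 case: (c _ _).
case E : (c i ord0 (+) c j ord0); [apply: (sep l) | apply: (sep k)];
  by rewrite E.
Qed.

(** * Parity and strictly submodular functions *)

Definition parity (R : realType) n (x : cube n) : R :=
  \prod_(k < n) (-1) ^+ x k.

Lemma diff2_parity (R : realType) n (i j : 'I_n) (x : cube n) : i != j ->
  diff2 (@parity R n) i j x
  = 4 * \prod_(k < n | (k != i) && (k != j)) (-1) ^+ x k.
Proof.
move=> ij; set P := \prod_(_ < _ | _) _.
have E a b : parity R (upd2 i j a b x) = (-1) ^+ a * ((-1) ^+ b * P).
  rewrite /parity (bigD1 i) //= (bigD1 j) /=; last by rewrite eq_sym.
  rewrite !ffunE !eqxx eq_sym (negPf ij); congr (_ * (_ * _)).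
  by apply: eq_bigr => k /andP[/negPf ki /negPf kj]; rewrite ffunE ki kj.
rewrite /diff2 !E /=; ring.
Qed.

Lemma diff2_parity_both_signs (R : realType) n (i j : 'I_n) :
  (2 < n)%N -> i != j ->
  (exists x, diff2 (@parity R n) i j x < 0) /\
  (exists x, 0 < diff2 (@parity R n) i j x).
Proof.
move=> n_gt2 ij; split; last first.
  exists [ffun=> false]; rewrite diff2_parity // big1 ?mulr1 // => k _.
  by rewrite ffunE expr0.
(* Raising a third coordinate l changes the sign. *)
have /card_gt0P[l] : (0 < #|~: [set i; j]%SET|)%N.
  by rewrite finset.cardsCs finset.setCK finset.cards2 ij card_ord subn_gt0.
rewrite !inE negb_or => lij.
exists [ffun k => k == l]; rewrite diff2_parity // (bigD1 l) //= big1.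
  by rewrite ffunE eqxx; lra.
by move=> k /andP[_ /negPf kl]; rewrite ffunE kl.
Qed.

Lemma neg_cone_diff2_le0 (R : realType) n (f : cube n -> R) (i j : 'I_n) x :
  neg_cone (supermodular_cone (fun _ : 'I_n => 1%Z)) f -> i != j ->
  diff2 f i j x <= 0.
Proof.
move=> [pi [pi1 /supermodularP fpi]] ij; have := fpi i j x ij.
have notrev k : reversed pi k = false.
  have := pi1 k; rewrite /sign_vector /reversed le01_tf.
  by case: (pi k false true).
by rewrite !notrev expr0 mul1r /diff2; lra.
Qed.

(** An interior point of the submodular cone stays in it after adding a small
    multiple of (x_1 + ... + x_n)^2, whose second differences are all 2; so its
    own second differences are negative, not just nonpositive. *)
Lemma interior_neg_cone_diff2_lt0 (R : realType) n (f : {ptws cube n -> R})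
    (i j : 'I_n) x :
  (neg_cone (supermodular_cone (fun _ : 'I_n => 1%Z)))° f -> i != j ->
  diff2 f i j x < 0.
Proof.
move=> f_int ij.
pose q : cube n -> R := sqr_form R (fun=> false).
pose u (m : nat) : {ptws cube n -> R} := fun y => f y + m.+1%:R^-1 * q y.
have u_f : u @ \oo --> f.
  apply/cvg_sup => y U [_ [[W oW <-] Wfy WU]]; apply: (filterS WU).
  have u_fy : (fun m => u m y) @ \oo --> f y.
    rewrite -[f y in X in _ --> X]addr0; apply: cvgD; first exact: cvg_cst.
    rewrite -[X in _ --> X](mul0r (q y)); apply: cvgMl; exact: cvg_harmonic.
  by apply: u_fy; exact: open_nbhs_nbhs.
have [m _ um] := u_f _ f_int.
have := neg_cone_diff2_le0 x (um m (leqnn m)) ij.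
have -> : diff2 (u m) i j x = diff2 f i j x + m.+1%:R^-1 * 2.
  rewrite -[2]mulr1 -[1](expr0 (-1)) -(diff2_sqr_form R (fun=> false) x ij).
  rewrite /diff2 /u /q; ring.
by apply: lt_le_trans; rewrite ltrDl mulr_gt0 ?invr_gt0.
Qed.

(** * The supermodular rank *)

Lemma supermodular_rank_le (R : realType) n (f : cube n -> R) s :
  supermodular_sum f s ->
  exists2 r, is_supermodular_rank f r & (r <= s)%N.
Proof.
move=> f_s; have ex : exists r, `[< supermodular_sum f r >].
  by exists s; apply/asboolP.
have [r /asboolP f_r r_min] := ex_minnP ex.
exists r; last by apply: r_min; apply/asboolP.
by split=> // t f_t; apply: r_min; apply/asboolP.
Qed.

(** One more order, which reverses no coordinate, makes all codewords start with
    the same bit, so that no two of them are antipodal. *)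
Lemma supermodular_sum_up_logS (R : realType) n (f : cube n -> R) :
  supermodular_sum f (up_log 2 n).+1.
Proof.
have [c c_sep] := exists_separating (up_logP n (isT : (1 < 2)%N)).
apply: (@supermodular_sum_of_separating R n f _
  (fun i k => if unlift ord0 k is Some l then c i l else false)) => //.
  by move=> i j /c_sep[k ck]; exists (lift ord0 k); rewrite !liftK.
by move=> i j x _ /(_ ord0); rewrite !unlift_none.
Qed.

Theorem theorem10 (R : realType) (n : nat) (hn : (3 <= n)%N) :
  ((forall f : cube n -> R, exists2 r : nat,
      is_supermodular_rank f r & (r <= up_log 2 n + 1)%N) /\
   (exists f : cube n -> R, is_supermodular_rank f (up_log 2 n + 1)%N)) /\
  (forall f : {ptws cube n -> R},
     (neg_cone (supermodular_cone (fun _ : 'I_n => 1%Z)))° f ->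
     is_supermodular_rank f (up_log 2 n)).
Proof.
have n_gt1 : (1 < n)%N by exact: ltnW.
rewrite addn1; split; [split|].
- by move=> f; apply: supermodular_rank_le; exact: supermodular_sum_up_logS.
- exists (@parity R n).
  split=> [|s]; first exact: supermodular_sum_up_logS.
  apply: up_log_lt_of_diff2_both_signs => // i j ij.
  exact: diff2_parity_both_signs.
- move=> f f_int; split=> [|s].
    have [c c_sep] := exists_separating (up_logP n (isT : (1 < 2)%N)).
    apply: (@supermodular_sum_of_separating R n f _ c) => //.
      by rewrite up_log_gt0.
    move=> i j x ij _; apply: neg_cone_diff2_le0 => //.
    exact: interior_subset.
  apply: up_log_le_of_diff2_lt0 => i j ij; exists [ffun=> false].
  exact: interior_neg_cone_diff2_lt0.
Qed.
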